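(* Let $n\geq 3$ and $m\geq 2$, and let $\Lambda$ be a normal propositional monomodal logic such that $\mathbf{K}+Alt_n\subseteq\Lambda\subseteq\mathbf{K}+Alt_n+\square^m\bot$. Then $\Lambda$ and $\mathbf{S5}$ are neither product-matching nor semiproduct-matching; that is, $[\Lambda,\mathbf{S5}]\neq\Lambda\times\mathbf{S5}$ and $[\Lambda,\mathbf{S5}]^{\mathrm{EX}}\neq\Lambda\rightthreetimes\mathbf{S5}$.
   Context: All propositional modal logics are normal. $\Lambda$ is in the language with the modality $\square$ (dual $\Diamond$), and $\mathbf{S5}$ is in the language with the modality $\blacksquare$. $L+A$ denotes the smallest normal modal logic containing $L$ and the formula $A$; $\mathbf{K}$ is the minimal normal modal logic; $\square^m$ is $\square$ iterated $m$ times. $Alt_n$ is the standard axiom saying that every point has at most $n$ successors: $\bigwedge_{0\le i\le n}\Diamond p_i\to\bigvee_{0\le i<j\le n}\Diamond(p_i\wedge p_j)$. $[\Lambda,\mathbf{S5}]^{\mathrm{EX}}:=\Lambda*\mathbf{S5}+(\square\blacksquare p\to\blacksquare\square p)$ and $[\Lambda,\mathbf{S5}]:=[\Lambda,\mathbf{S5}]^{\mathrm{EX}}+(\blacksquare\square p\to\square\blacksquare p)$, where $*$ denotes fusion (the smallest normal bimodal logic containing both). The product of Kripke frames $F_1=(U_1,R_1)$ and $F_2=(U_2,R_2)$ is $F_1\times F_2:=(U_1\times U_2,R_h,R_v)$ with $R_h(u,v)=R_1(u)\times\{v\}$ and $R_v(u,v)=\{u\}\times R_2(v)$, where $R(x)=\{y\mid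 xRy\}$. A semiproduct of $F_1$ and $F_2$ is a restriction of $F_1\times F_2$ to a nonempty subset $W\subseteq U_1\times U_2$ such that $R_h(W)\subseteq W$. The modality $\square$ is interpreted by $R_h$ and $\blacksquare$ by $R_v$. $\Lambda\times\mathbf{S5}$ (respectively $\Lambda\rightthreetimes\mathbf{S5}$) is the bimodal logic (set of valid formulas) of the class of all products (respectively semiproducts) of $\Lambda$-frames with $\mathbf{S5}$-frames (an $L$-frame is a Kripke frame validating $L$). *)

(* Defs.v *)
From mathcomp Require Import all_boot.
From mathcomp Require Import classical_sets.

Set Implicit Arguments.
Unset Strict Implicit.
Unset Printing Implicit Defensive.

Local Open Scope classical_set_scope.

(* Modal formulas whose boxes are indexed by [I]. *)
Inductive form (I : Type) : Type :=
| Var of nat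
| Bot
| Imp of form I & form I
| Box of I & form I.

Arguments Var {I} _.
Arguments Bot {I}.

Section Connectives.
Context {I : Type}.
Implicit Types A B : form I.

Definition Neg A := Imp A Bot.
Definition Top : form I := Neg Bot.
Definition And A B := Neg (Imp A (Neg B)).
Definition Or A B := Imp (Neg A) B.
Definition Dia (i : I) A := Neg (Box i (Neg A)).

Fixpoint subst (s : nat -> form I) A : form I :=
  match A with
  | Var k => s k
  | Bot => Bot
  | Imp B C => Imp (subst s B) (subst s C)
  | Box i B => Box i (subst s B)
  end.

(* Variables and boxed formulas get independent truth values. *)
Definition tautology A : Prop :=
  forall v : form I -> bool,
    v Bot = false -> (forall B C, v (Imp B C) = (v B ==> v C)) -> v A = true.

Definition axiomK (i : I) : form I :=
  Imp (Box i (Imp (Var 0) (Var 1))) (Imp (Box i (Var 0)) (Box i (Var 1))).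

Record normal (L : set (form I)) : Prop := Normal {
  normal_taut : tautology `<=` L;
  normal_K : forall i, L (axiomK i);
  normal_MP : forall A B, L A -> L (Imp A B) -> L B;
  normal_subst : forall s A, L A -> L (subst s A);
  normal_nec : forall i A, L A -> L (Box i A) }.

Definition logicK : set (form I) := smallest normal set0.

(* L + A *)
Definition extend (L : set (form I)) A : set (form I) :=
  smallest normal (L `|` [set A]).

End Connectives.

Fixpoint reindex (I J : Type) (f : I -> J) (A : form I) : form J :=
  match A with
  | Var k => Var k
  | Bot => Bot
  | Imp B C => Imp (reindex f B) (reindex f C)
  | Box i B => Box (f i) (reindex f B)
  end.

Definition mform := form unit.

Definition box : mform -> mform := Box tt.
Definition dia : mform -> mform := Dia tt.

Definition Alt (n : nat) : mform :=
  Imp (\big[And/Top]_(i < n.+1) dia (Var i))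
      (\big[Or/Bot]_(i < n.+1) \big[Or/Bot]_(j < n.+1 | i < j)
          dia (And (Var i) (Var j))).

Definition S5 : set mform :=
  extend (extend (extend logicK
    (Imp (box (Var 0)) (Var 0)))
    (Imp (box (Var 0)) (box (box (Var 0)))))
    (Imp (dia (Var 0)) (box (dia (Var 0)))).

(* [Hor] is the modality read by R_h (the white box), [Ver] the one read by
   R_v (the black box). *)
Inductive modality2 := Hor | Ver.

Definition bform := form modality2.

Definition fusion (L1 L2 : set mform) : set bform :=
  smallest normal ((reindex (fun=> Hor) @` L1) `|` (reindex (fun=> Ver) @` L2)).

(* [L1, L2]^EX *)
Definition ecommutator (L1 L2 : set mform) : set bform :=
  extend (fusion L1 L2)
    (Imp (Box Hor (Box Ver (Var 0))) (Box Ver (Box Hor (Var 0)))).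

(* [L1, L2] *)
Definition commutator (L1 L2 : set mform) : set bform :=
  extend (ecommutator L1 L2)
    (Imp (Box Ver (Box Hor (Var 0))) (Box Hor (Box Ver (Var 0)))).

Record frame (I : Type) : Type := Frame {
  world :> Type;
  rel_of : I -> world -> world -> Prop;
  world_nonempty : inhabited world }.

Fixpoint sat (I : Type) (F : frame I) (v : nat -> set F) (A : form I) (w : F) :
    Prop :=
  match A with
  | Var k => v k w
  | Bot => False
  | Imp B C => sat v B w -> sat v C w
  | Box i B => forall w' : F, rel_of i w w' -> sat v B w'
  end.

Definition valid (I : Type) (F : frame I) (A : form I) : Prop :=
  forall (v : nat -> set F) (w : F), sat v A w.

Definition frames (I : Type) (L : set (form I)) : set (frame I) :=
  [set F | forall A, L A -> valid F A].

Definition logic_of (I : Type) (C : set (frame I)) : set (form I) :=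
  [set A | forall F, C F -> valid F A].

Definition product_rel (F1 F2 : frame unit) (i : modality2) (x y : F1 * F2) :
    Prop :=
  match i with
  | Hor => rel_of tt x.1 y.1 /\ y.2 = x.2
  | Ver => y.1 = x.1 /\ rel_of tt x.2 y.2
  end.

Lemma product_nonempty (F1 F2 : frame unit) : inhabited (F1 * F2).
Proof. by case: (world_nonempty F1) => u; case: (world_nonempty F2) => v. Qed.

Definition product (F1 F2 : frame unit) : frame modality2 :=
  Frame (@product_rel F1 F2) (product_nonempty F1 F2).

Lemma restrict_nonempty (T : Type) (W : set T) :
  W !=set0 -> inhabited {x : T | W x}.
Proof. by case=> x Wx; split; exists x. Qed.

Definition restrict (I : Type) (F : frame I) (W : set F) (W0 : W !=set0) :
    frame I :=
  @Frame I {x : F | W x} (fun i x y => rel_of i (sval x) (sval y))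
    (restrict_nonempty W0).

Definition products (L1 L2 : set mform) : set (frame modality2) :=
  [set product F1 F2 | F1 in frames L1 & F2 in frames L2].

Definition semiproducts (L1 L2 : set mform) : set (frame modality2) :=
  [set F | exists (F1 F2 : frame unit) (W : set (product F1 F2))
             (W0 : W !=set0),
     [/\ frames L1 F1, frames L2 F2,
         (forall x y : product F1 F2, W x -> rel_of Hor x y -> W y)
       & F = restrict W0]].

Definition product_logic (L1 L2 : set mform) : set bform :=
  logic_of (products L1 L2).

Definition semiproduct_logic (L1 L2 : set mform) : set bform :=
  logic_of (semiproducts L1 L2).

(* Main.v *)
(** In a restriction of a product, all points of a vertical cluster share the
    first coordinate, hence the set of horizontal successors of that first
    coordinate, and whether such a successor [s] carries [■p] or [■¬p] at a
    point of its row decides [p] at every point of the row related to it. So if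
    one point of the cluster has [n-1] distinct successors in [■p] and a related
    one has two distinct successors in [■¬p], then [n+1] distinct successors
    contradict [Alt_n]. The commutator only requires each point of the cluster
    to see the two leaf clusters, without fixing how its [n] successors are
    distributed among them: a frame of depth one in which two roots
    distribute their successors differently refutes the formula. *)

Require Import Defs.
From mathcomp Require Import all_boot zify.
From mathcomp Require Import boolp classical_sets.

Set Implicit Arguments.
Unset Strict Implicit.
Unset Printing Implicit Defensive.

Local Open Scope classical_set_scope.

(** * Semantics of the derived connectives *)

Section Satisfaction.
Context {I : Type} {F : frame I} (v : nat -> set F).
Implicit Types (A B : form I) (w : F).

Lemma sat_Imp A B w : sat v (Imp A B) w = (sat v A w -> sat v B w).
Proof. by []. Qed.

Lemma sat_And A B w : sat v (And A B) w <-> sat v A w /\ sat v B w.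
Proof.
split=> /= [nAB|[sA sB] nAB]; last exact: nAB.
by split; apply: contrapT => nX; apply: nAB => // sA sB; apply: nX.
Qed.

Lemma sat_Or A B w : sat v (Or A B) w <-> sat v A w \/ sat v B w.
Proof.
split=> /= [nAB|[sA /(_ sA)//|//]].
by have [sA|nA] := pselect (sat v A w); [left|right; apply: nAB].
Qed.

Lemma sat_Dia i A w :
  sat v (Dia i A) w <-> exists2 w', rel_of i w w' & sat v A w'.
Proof.
split=> /= [nA|[w' ww' sA] /(_ w' ww')/(_ sA)//].
by apply: contrapT => nE; apply: nA => w' ww' sA; apply: nE; exists w'.
Qed.

Lemma sat_bigAnd (J : finType) (P : pred J) (f : J -> form I) w :
  sat v (\big[And/Top]_(j | P j) f j) w <-> forall j, P j -> sat v (f j) w.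
Proof.
suff h (r : seq J) : sat v (\big[And/Top]_(j <- r | P j) f j) w <->
    forall j, j \in r -> P j -> sat v (f j) w.
  by rewrite h; split=> H j => [|_]; apply: H; rewrite mem_index_enum.
elim: r => [|k r IH]; first by rewrite big_nil; split=> // _ [].
rewrite big_cons; case: ifPn => Pk; rewrite ?sat_And IH.
  split=> [[fk fr] j|fr]; last first.
    by split=> [|j jr Pj]; apply: fr; rewrite // inE ?eqxx ?jr ?orbT.
  by rewrite inE => /orP[/eqP-> //|jr Pj]; apply: fr.
split=> fr j => [|jr]; last by apply: fr; rewrite inE jr orbT.
by rewrite inE => /orP[/eqP-> /(negP Pk)|]; last exact: fr.
Qed.

Lemma sat_bigOr (J : finType) (P : pred J) (f : J -> form I) w :
  sat v (\big[Or/Bot]_(j | P j) f j) w <-> exists2 j, P j & sat v (f j) w.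
Proof.
suff h (r : seq J) : sat v (\big[Or/Bot]_(j <- r | P j) f j) w <->
    exists j, [/\ j \in r, P j & sat v (f j) w].
  by rewrite h; split=> [[j []]|[j]]; exists j; rewrite ?mem_index_enum.
elim: r => [|k r IH]; first by rewrite big_nil; split=> // -[j []].
rewrite big_cons; case: ifPn => Pk; rewrite ?sat_Or IH; split.
- case=> [fk|[j [jr Pj fj]]]; first by exists k; rewrite inE eqxx.
  by exists j; rewrite inE jr orbT.
- case=> j []; rewrite inE => /orP[/eqP->|jr] Pj fj; first by left.
  by right; exists j.
- by case=> j [jr Pj fj]; exists j; rewrite inE jr orbT.
- case=> j []; rewrite inE => /orP[/eqP-> /(negP Pk)//|jr] Pj fj.
  by exists j.
Qed.

Lemma sat_subst s A w :
  sat v (subst s A) w <-> sat (fun k => sat v (s k)) A w.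
Proof.
elim: A w => [k|//|B IHB C IHC|i B IHB] w //=; first by rewrite IHB IHC.
by split=> h w' /h /IHB.
Qed.

End Satisfaction.

(** * Soundness on frames and the frame condition of [Alt n] *)

Lemma normal_valid I (F : frame I) : normal [set A | valid F A].
Proof.
split=> [A tA v w|i v w /= h h' w' ww'|A B hA hAB v w|s A hA v w|i A hA v w w' _].
- apply: asboolW; apply: (tA (fun B => `[< sat v B w >])); first exact/asboolP.
  by move=> B C; rewrite -asbool_imply.
- by apply: h => //; apply: h'.
- exact/hAB/hA.
- exact/sat_subst/hA.
- exact: hA.
Qed.

Lemma sub_extend I (L : set (form I)) A : L `<=` extend L A.
Proof. by move=> B LB X [_]; apply; left. Qed.

Lemma extend_axiom I (L : set (form I)) A : extend L A A.
Proof. by move=> X [_]; apply; right. Qed.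

Lemma extend_valid I (F : frame I) (L : set (form I)) A :
  L `<=` [set B | valid F B] -> valid F A ->
  extend L A `<=` [set B | valid F B].
Proof.
move=> hL hA; apply: smallest_sub; first exact: normal_valid.
by move=> B [/hL//|->].
Qed.

Lemma logicK_valid I (F : frame I) : logicK `<=` [set A | valid F A].
Proof. by apply: smallest_sub; first exact: normal_valid. Qed.

Definition reduct I J (f : I -> J) (F : frame J) : frame I :=
  Frame (fun i => rel_of (f i)) (world_nonempty F).

Lemma valid_reindex I J (f : I -> J) (F : frame J) A :
  valid F (Defs.reindex f A) <-> valid (reduct f F) A.
Proof.
suff h v w : sat v (Defs.reindex f A) w <-> @sat I (reduct f F) v A w.
  by split=> H v w; apply/h/H.
elim: A w => [k|//|B IHB C IHC|i B IHB] w //=; first by rewrite IHB IHC.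
by split=> H w' /H /IHB.
Qed.

Lemma valid_Alt (F : frame unit) n :
  valid F (Alt n) <->
  forall (w : F) (s : 'I_n.+1 -> F), (forall i, rel_of tt w (s i)) ->
  exists i j : 'I_n.+1, i < j /\ s i = s j.
Proof.
split=> [hA w s ws|hF v w].
- have /= := hA (fun k => [set u | exists2 i, nat_of_ord i = k & s i = u]) w.
  rewrite sat_bigAnd sat_bigOr; case=> [i _|i _].
    by apply/sat_Dia; exists (s i); last exists i.
  case/sat_bigOr=> j ij /sat_Dia[u _] /sat_And[[i' ei <-] [j' ej]].
  by rewrite (ord_inj ei) (ord_inj ej) => ?; exists i, j.
- move=> /sat_bigAnd h.
  have /choice[s hs] : forall i : 'I_n.+1, exists u : F, rel_of tt w u /\ v i u.
    by move=> i; have /sat_Dia[u wu vu] := h i isT; exists u.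
  have [i|i [j [ij eij]]] := hF w s; first by case: (hs i).
  apply/sat_bigOr; exists i => //; apply/sat_bigOr; exists j => //.
  apply/sat_Dia; exists (s i); first by case: (hs i).
  by apply/sat_And; split; [case: (hs i)|rewrite eij; case: (hs j)].
Qed.

(** * The separating formula and its validity on products and semiproducts *)

(* [p] is [Var n.+1]; [Var i] for [i <= n] names the [i]-th successor. *)
Definition Split (n : nat) : bform :=
  Imp (And (\big[And/Top]_(i < n.+1 | i < n.-1)
              Dia Hor (And (Var i) (Box Ver (Var n.+1))))
           (Dia Ver (\big[And/Top]_(i < n.+1 | ~~ (i < n.-1))
              Dia Hor (And (Var i) (Box Ver (Neg (Var n.+1)))))))
      (Dia Ver (\big[Or/Bot]_(i < n.+1) \big[Or/Bot]_(j < n.+1 | i < j)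
         Dia Hor (And (Var i) (Var j)))).

(** The embedding [f] treats products (identity) and semiproducts ([sval]) at once. *)
Lemma Split_valid n (F1 F2 : frame unit) (G : frame modality2)
    (f : G -> product F1 F2) :
  injective f -> (forall i x y, rel_of i x y <-> rel_of i (f x) (f y)) ->
  valid F1 (Alt n) -> (forall u : F2, rel_of tt u u) -> valid G (Split n).
Proof.
move=> f_inj fE /valid_Alt altF1 reflF2 v x.
move=> /sat_And[/sat_bigAnd hx /sat_Dia[y xy /sat_bigAnd hy]].
have reflG (z : G) : rel_of Ver z z by apply/(fE Ver); split=> //; apply: reflF2.
have fxy : (f y).1 = (f x).1 by move/(fE Ver): xy => [].
(* The first [n.-1] witnesses are successors of [x], the last two of [y]; all project to successors
   of the single point [(f x).1]. *)
pose root (i : 'I_n.+1) := if i < n.-1 then x else y.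
have /choice[z hz] : forall i : 'I_n.+1, exists z : G,
    [/\ rel_of Hor (root i) z, v i z & forall z', rel_of Ver z z' ->
        v n.+1 z' <-> i < n.-1].
  move=> i; rewrite /root; case: ifPn => ilt.
    have /sat_Dia[z xz /sat_And[vz p]] := hx i ilt.
    by exists z; split=> // z' /p.
  have /sat_Dia[z yz /sat_And[vz np]] := hy i ilt.
  by exists z; split=> // z' /np nv; split=> // /nv.
have [i|i [j [ij eij]]] := altF1 (f x).1 (fun i => (f (z i)).1).
  have [] := hz i; rewrite /root; case: ifP => _ /(fE Hor)[] //.
  by rewrite fxy.
have [/(fE Hor)[_ zi2] vi pi] := hz i; have [/(fE Hor)[_ zj2] vj pj] := hz j.
(* Otherwise [i < n.-1 <= j], as [i < j]. Then [z j] is vertically accessible from [z i], so it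
   satisfies [p], and by reflexivity also its negation. *)
have ver_ij : (i < n.-1) = (j < n.-1).
  apply/idP/idP => lt.
  - have /(fE Ver)/pi : rel_of Ver (f (z i)) (f (z j)).
      split=> //; rewrite zi2 zj2 /root lt; case: ifP => // _.
      by move/(fE Ver): xy => [].
    by move=> /iffRL/(_ lt)/(pj _ (reflG _)).
  - by move: lt; lia.
have zij : z i = z j.
  apply: f_inj; move: eij zi2 zj2; rewrite /root ver_ij.
  by case: (f (z i)) (f (z j)) => [? ?] [? ?] /= -> -> ->.
(* The collision may occur above [x] or above [y], whence the vertical diamond in the conclusion of
   [Split]. *)
apply/sat_Dia; exists (root i).
  by rewrite /root; case: ifP => _; [apply: reflG|].
apply/sat_bigOr; exists i => //; apply/sat_bigOr; exists j => //.
apply/sat_Dia; exists (z i); first by case: (hz i).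
by apply/sat_And; split=> //=; rewrite zij.
Qed.

Lemma S5_refl (F : frame unit) : frames S5 F -> forall u : F, rel_of tt u u.
Proof.
move=> hF u; have hT : S5 (Imp (box (Var 0)) (Var 0)).
  by do 2 apply: sub_extend; apply: extend_axiom.
exact: (hF _ hT (fun=> rel_of tt u) u).
Qed.

Lemma Split_semiproduct n (L : set mform) :
  L (Alt n) -> semiproduct_logic L S5 (Split n).
Proof.
move=> Ln _ [F1 [F2 [W [W0 [hF1 hF2 _ ->]]]]].
apply: (@Split_valid n F1 F2 (restrict W0) (fun x => sval x)) => //; last exact: S5_refl.
  by move=> [x Wx] [y Wy] /= xy; subst y; rewrite (Prop_irrelevance Wx Wy).
exact: hF1.
Qed.

Lemma Split_product n (L : set mform) :
  L (Alt n) -> product_logic L S5 (Split n).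
Proof.
move=> Ln _ [F1 hF1 [F2 hF2 <-]].
by apply: (@Split_valid n F1 F2 (product F1 F2) id) => //; [exact: hF1|exact: S5_refl].
Qed.

(** * A frame of the commutator that refutes [Split n] *)

Section Fork.
Variable n : nat.
Hypothesis n_ge3 : 3 <= n.

(* Each root sees all leaves [0, ..., n] but one. These form the two vertical
   clusters [k < n.-1] and [n.-1 <= k <= n]; the leaves [k > n] are isolated
   junk points, which make every [nat] usable as an index: with ['I_n.+1] the
   worlds would live in a universe too large for [frame]. *)
Inductive fork_world : Set := Root of bool | Leaf of nat.

(** [Root true] keeps the whole first cluster, [Root false] keeps both [n.-1] and [n]. As [3 <= n],
    leaf 1 is in the first cluster and both roots still see [0] and [n.-1]. *)
Definition missed (b : bool) : nat := if b then n else 1.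

(** The value is a label: [maxn] merges [n.-1] with [n] and leaves each junk leaf alone. *)
Definition cluster (k : nat) : nat := if k < n.-1 then 0 else maxn n k.

Definition fork_rel (i : modality2) (x y : fork_world) : Prop :=
  match i, x, y with
  | Hor, Root b, Leaf k => k <= n /\ k <> missed b
  | Ver, Root _, Root _ => True
  | Ver, Leaf k, Leaf l => cluster k = cluster l
  | _, _, _ => False
  end.

Definition fork : frame modality2 := Frame fork_rel (inhabits (Root true)).

Lemma fork_Alt : valid (reduct (fun=> Hor) fork) (Alt n).
Proof.
apply/valid_Alt => -[b|k] s ws; last by have := ws ord0.
have /choice[l hl] : forall i, exists k : 'I_n.+1,
    s i = Leaf k /\ k <> missed b :> nat.
  move=> i; have /= := ws i; case: (s i) => // k [kn kb].
  by exists (inord k); rewrite inordK.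
have missed_lt : missed b < n.+1 by rewrite /missed; case: b {ws hl}; lia.
have /injectivePn[i [j ij eij]] : ~~ injectiveb l.
  (* An injection of ['I_n.+1] into itself is onto, so it would hit the missed leaf. *)
  apply/injectiveP => l_inj.
  by have [_] := hl (invF l_inj (Ordinal missed_lt)); rewrite f_invF.
have sij : s i = s j by rewrite (hl i).1 (hl j).1 eij.
by move: ij; rewrite neq_ltn => /orP[ij|ij]; [exists i, j|exists j, i].
Qed.

Lemma fork_nilpotent m : 2 <= m ->
  valid (reduct (fun=> Hor) fork) (iter m box Bot).
Proof.
case: m => [|[|m]]// _; rewrite !iterS => v w /=.
by case: w => [b|k] [b'|l] // _ [b''|l'].
Qed.

Lemma fork_S5 : S5 `<=` [set A | valid (reduct (fun=> Ver) fork) A].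
Proof.
apply: extend_valid; first apply: extend_valid; first apply: extend_valid.
- exact: logicK_valid.
- by move=> v [b|k] /= h; apply: h.
- by move=> v [b|k] /= h [?|l] // e1 [?|l'] // e2; apply: h; rewrite // e1.
- move=> v w; rewrite sat_Imp => /sat_Dia[u wu vu] w' ww'.
  apply/(sat_Dia v tt (Var 0)).
  by exists u => //; move: wu ww' {vu}; case: w; case: u; case: w' => //= ? ? ? -> ->.
Qed.

Lemma fork_commutator m (L : set mform) : 2 <= m ->
  L `<=` extend (extend logicK (Alt n)) (iter m box Bot) ->
  commutator L S5 `<=` [set A | valid fork A].
Proof.
move=> m_ge2 L_le.
apply: extend_valid; first apply: extend_valid.
- apply: smallest_sub; first exact: normal_valid.
  move=> _ [] [A hA <-]; apply/valid_reindex; last exact: fork_S5.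
  move: A {hA}(L_le _ hA); apply: extend_valid; last exact: fork_nilpotent.
  by apply: extend_valid fork_Alt; apply: logicK_valid.
- move=> v [b|k] /= h [b'|l] // _ [//|k] [kn _].
  (* These representatives of the two clusters are seen from both roots. *)
  apply: (h (Leaf (if k < n.-1 then 0 else n.-1))); last first.
    by rewrite /= /cluster; case: (ifP (k < n.-1)) => ?; case: ifP; lia.
  by rewrite /= /missed; case: ifP; case: b {h}; lia.
- move=> v [b|k] /= h [b'|l] // [ln _] [//|k] lk.
  (* Here [k <= n], since [k] shares the cluster of [l]. [Root true] misses only [n], which
     [Root false] sees. *)
  apply: (h (Root (k < n))) => //=; move: lk; rewrite /cluster /missed.
  by case: (ltnP l) => ?; case: (ltnP k n.-1) => ?; case: (ltnP k n); lia.
Qed.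

Lemma fork_Split : ~ valid fork (Split n).
Proof.
(* Each leaf up to [n] has its own name, so no point bears two; [p] holds exactly on the first
   cluster. *)
pose v k : set fork := [set x | exists2 l, x = Leaf l &
  if k <= n then l = k else l < n.-1].
have vE (i : 'I_n.+1) l : v i (Leaf l) <-> l = i.
  by rewrite /v /= -ltnS ltn_ord; split=> [[_ [<-]]|->]; last exists i.
have pE l : v n.+1 (Leaf l) <-> l < n.-1.
  by rewrite /v /= ltnn; split=> [[_ [<-]]|] //; exists l.
have clusterE k l : cluster k = cluster l -> (k < n.-1) = (l < n.-1).
  by rewrite /cluster; case: ifP; case: ifP; lia.
move=> /(_ v (Root true)); rewrite /Split sat_Imp => h.
have [|x _] := (sat_Dia _ _ _ _).1 (h _).
  apply/sat_And; split.
    apply/sat_bigAnd => i ilt; apply/sat_Dia; exists (Leaf i).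
      by rewrite /= /missed; lia.
    apply/sat_And; split=> [|[//|l] /clusterE il]; first exact/vE.
    by apply/pE; rewrite -il.
  apply/sat_Dia; exists (Root false) => //.
  apply/sat_bigAnd => i ige; apply/sat_Dia; exists (Leaf i).
    by rewrite /= /missed; have := ltn_ord i; lia.
  apply/sat_And; split=> [|[//|l] /clusterE il]; first exact/vE.
  by move/pE; rewrite -il; apply/negP.
case/sat_bigOr=> i _ /sat_bigOr[j ij] /sat_Dia[[b|l] _] /sat_And[].
  by case.
by move=> /vE -> /vE e; move: ij; rewrite e ltnn.
Qed.

End Fork.

Theorem theorem3p3 (n m : nat) (Lambda : set mform)
    (hn : 3 <= n) (hm : 2 <= m) (Lambda_normal : normal Lambda)
    (Lambda_ge : extend logicK (Alt n) `<=` Lambda)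
    (Lambda_le :
      Lambda `<=` extend (extend logicK (Alt n)) (iter m box Bot)) :
  commutator Lambda S5 <> product_logic Lambda S5 /\
  ecommutator Lambda S5 <> semiproduct_logic Lambda S5.
Proof.
have LA : Lambda (Alt n) by apply: Lambda_ge; apply: extend_axiom.
have notin : ~ commutator Lambda S5 (Split n).
  by move=> /(fork_commutator hn hm Lambda_le); apply: fork_Split.
split=> eqL; apply: notin.
  by rewrite eqL; apply: Split_product.
(* The commutator extends the e-commutator, so refuting [Split] in the former settles both
   claims. *)
by apply: sub_extend; rewrite eqL; apply: Split_semiproduct.
Qed.
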